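(* Let $X\subset\mathbb R^{2n}$ be a centrally symmetric convex body such that $X^\omega\subseteq X$. Then $$c_{ZA}(X)\ge 3.$$
   Context: A convex body is a compact convex set with nonempty interior; it is centrally symmetric if $X=-X$. Let $\omega$ be the standard symplectic form on $\mathbb R^{2n}$. The symplectic polar of a convex body $X$ with the origin in its interior is $X^\omega=\{y\in\mathbb R^{2n} : \omega(x,y)\le 1\ \forall x\in X\}$. For a symplectic linear subspace $L\subset\mathbb R^{2n}$ (i.e. $\omega_L:=\omega|_L$ is nondegenerate), let $L^{\perp_\omega}=\{y:\omega(x,y)=0\ \forall x\in L\}$, so $\mathbb R^{2n}=L\oplus L^{\perp_\omega}$, and let $\pi_{L,\omega}$ be the projection onto $L$ along $L^{\perp_\omega}$. The cylindrical affine capacity of a convex body $X\subset\mathbb R^{2n}$ is $$c_{ZA}(X)=\inf_L \operatorname{vol}(\pi_{L,\omega}(X)),$$ the infimum over all two-dimensional symplectic linear subspaces $L\subset\mathbb R^{2n}$, where the area on $L$ is the one defined by $\omega_L$ (a parallelogram spanned by $u,v\in L$ has area $|\omega(u,v)|$). *)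

(* Defs.v *)
From HB Require Import structures.
From mathcomp Require Import all_boot all_order all_algebra.
From mathcomp Require Import all_classical all_reals all_analysis.
From mathcomp Require Import ring.

Set Implicit Arguments.
Unset Strict Implicit.
Unset Printing Implicit Defensive.

Import Order.TTheory GRing.Theory Num.Theory.
Import numFieldNormedType.Exports.

Local Open Scope classical_set_scope.
Local Open Scope ring_scope.

(* R^2n is 'rV[R]_(n + n), with coordinates (q_1, .., q_n, p_1, .., p_n). *)
Definition omega (R : realType) (n : nat) (x y : 'rV[R]_(n + n)) : R :=
  \sum_(i < n) (x 0 (lshift n i) * y 0 (rshift n i) -
                x 0 (rshift n i) * y 0 (lshift n i)).

Lemma omega_bilinear (R : realType) (n : nat) :
  bilinear_for *%R (idfun \; *%R) (@omega R n).
Proof.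
split=> [y a u v|x a u v]; rewrite /omega /= mulr_sumr -big_split /=;
  by apply: eq_bigr => i _; rewrite !mxE; ring.
Qed.

HB.instance Definition _ (R : realType) (n : nat) :=
  bilinear_isBilinear.Build R 'rV[R]_(n + n) 'rV[R]_(n + n) R
    *%R (idfun \; *%R) (@omega R n) (@omega_bilinear R n).

Lemma omega_skew (R : realType) (n : nat) (x y : 'rV[R]_(n + n)) :
  omega x y = (-1) ^+ true * idfun (omega y x).
Proof.
rewrite /omega expr1 mulN1r /= -sumrN; apply: eq_bigr => i _.
by ring.
Qed.

HB.instance Definition _ (R : realType) (n : nat) :=
  @isHermitianSesquilinear.Build R 'rV[R]_(n + n) true idfun
    (@omega R n) (@omega_skew R n).

Definition convex_body (R : realType) (m : nat) (X : set 'rV[R]_m) : Prop :=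
  [/\ compact X, convex_set (X : set (convex_lmodType 'rV[R]_m))
    & X^° !=set0].

Definition centrally_symmetric (R : realType) (m : nat) (X : set 'rV[R]_m) :
  Prop := X = [set - x | x in X].

Definition symplectic_polar (R : realType) (n : nat) (X : set 'rV[R]_(n + n)) :
  set 'rV[R]_(n + n) := [set y | forall x, X x -> omega x y <= 1].

(* The restriction of omega to L is nondegenerate. *)
Definition symplectic_subspace (R : realType) (n : nat)
    (L : {vspace 'rV[R]_(n + n)}) : Prop :=
  forall x, x \in L -> {in L, forall y, omega x y = 0} -> x = 0.

Definition omega_orth (R : realType) (n : nat) (L : {vspace 'rV[R]_(n + n)}) :
  {vspace 'rV[R]_(n + n)} := orthov (@omega R n) L.

Lemma omega_orthP (R : realType) (n : nat) (L : {vspace 'rV[R]_(n + n)})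
    (y : 'rV[R]_(n + n)) :
  y \in omega_orth L <-> {in L, forall x, omega x y = 0}.
Proof.
split=> [/mem_orthovP yL x xL | yL].
  by rewrite omega_skew [omega y x](yL _ xL) mulr0.
by apply/mem_orthovP => x xL; rewrite -[LHS]/(omega y x) omega_skew yL // mulr0.
Qed.

Definition symplectic_proj (R : realType) (n : nat)
    (L : {vspace 'rV[R]_(n + n)}) : 'End('rV[R]_(n + n)) :=
  daddv_pi L (omega_orth L).

(* For \dim L = 2: the Lebesgue measure of S in the coordinates of a basis
   (u, v) of L, scaled so that the parallelogram spanned by u and v has area
   |omega u v|; by the change of variables formula this does not depend on
   the basis.  Meaningless if \dim L <> 2. *)
Definition omega_area (R : realType) (n : nat) (L : {vspace 'rV[R]_(n + n)})
    (S : set 'rV[R]_(n + n)) : \bar R :=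
  let u := (vbasis L)`_0 in
  let v := (vbasis L)`_1 in
  (`|omega u v|%:E *
   (@lebesgue_measure R \x @lebesgue_measure R)
     [set ab : R * R | S (ab.1 *: u + ab.2 *: v)%R])%E.

(* The infimum is taken in \bar R, the area being \bar R-valued. *)
Definition cyl_affine_capacity (R : realType) (n : nat)
    (X : set 'rV[R]_(n + n)) : \bar R :=
  ereal_inf [set omega_area L (symplectic_proj L @` X) |
    L in [set L : {vspace 'rV[R]_(n + n)} |
           \dim L = 2%N /\ symplectic_subspace L]].

(* Main.v *)
(* Projecting to L turns X^omega `<=` X into K^omega `<=` K for the planar body
   K = pi_L(X), since K^omega = X^omega `&` L. In the plane, take p, q with p, q
   and q - p in K and a = omega(p, q) maximal. The hexagon with vertices
   +-p, +-q, +-(q - p) has area 3a, which settles the case a >= 1.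
   If a < 1, then maximality forces the vertices to be on the boundary of K. For
   consecutive vertices x, y the difference y - x is again a vertex, so polarity
   yields a point u of K with omega(u, y - x) >= 1. As x and y are boundary
   points, u lies in the sector between them, and the quadrilateral 0, x, u, y
   has area omega(u, y - x) / 2 >= 1/2. The six sectors give at least 3. *)
Require Import Defs.
From mathcomp Require Import all_boot all_order all_algebra.
From mathcomp Require Import all_classical all_reals all_analysis.
From mathcomp Require Import measurable_realfun ring lra.

Set Implicit Arguments.
Unset Strict Implicit.
Unset Printing Implicit Defensive.

Import Order.TTheory GRing.Theory Num.Theory.
Import numFieldNormedType.Exports.

Local Open Scope classical_set_scope.
Local Open Scope ring_scope.

(** * Planar Lebesgue measure: shears, triangles, convex sets in sectors *)

Section planar_area.
Variable R : realType.
Local Notation leb := (@lebesgue_measure R).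
Local Notation leb2 := (@lebesgue_measure R \x @lebesgue_measure R)%E.
Implicit Types (A B S : set (R * R)) (p q u z : R * R).

(** The pushforward under a translation agrees with [leb] on half-open intervals, which determine
    the measure. *)
Lemma lebesgue_measure_translation (c : R) (A : set R) : measurable A ->
  leb [set x | A (x + c)] = leb A.
Proof.
move=> mA.
have mf : measurable_fun setT ((fun x => x + c) : R -> measurableTypeR R).
  exact: measurable_funD.
pose m := pushforward leb ((fun x => x + c) : R -> measurableTypeR R).
apply/esym; rewrite -[RHS]/(m A).
apply: lebesgue_measure_unique => // _ [[a b]] _ <-.
transitivity (leb `]a - c, b - c]%classic).
  rewrite !lebesgue_measure_itv/= !lte_fin ltrD2r -!EFinD opprD addrACA subrr.
  by rewrite addr0.
congr lebesgue_measure; apply/seteqP.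
by split => x /=; rewrite !in_itv/= ltrBlDr lerBrDr.
Qed.

(** The product measure integrates vertical sections by definition, whereas a horizontal shear
    translates the horizontal ones. *)
Lemma product_lebesgueC A : measurable A ->
  leb2 A = (\int[leb]_t leb (ysection A t))%E.
Proof.
move=> mA; rewrite (product_measure_unique (m' := (leb \x^ leb)%E))//.
by move=> B C mB mC; rewrite /= product_measure2E.
Qed.

Lemma leb2_hshear (k : R) A : measurable A ->
  measurable [set z : R * R | A (z.1 + k * z.2, z.2)] /\
  leb2 [set z : R * R | A (z.1 + k * z.2, z.2)] = leb2 A.
Proof.
move=> mA.
have mB : measurable [set z : R * R | A (z.1 + k * z.2, z.2)].
  rewrite -[X in measurable X]setTI.
  apply: (_ : measurable_fun setT
    (fun z : R * R => (z.1 + k * z.2, z.2))) => //.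
  apply: measurable_fun_pair => //.
  by apply: measurable_funD => //; apply: measurable_funM.
split=> //; rewrite !product_lebesgueC//; apply: eq_integral => t _.
rewrite -[RHS](lebesgue_measure_translation (k * t)); last first.
  exact: measurable_ysection.
by congr lebesgue_measure; apply/seteqP; split => x /=; rewrite !ysectionE.
Qed.

Lemma leb2_vshear (k : R) A : measurable A ->
  measurable [set z : R * R | A (z.1, z.2 + k * z.1)] /\
  leb2 [set z : R * R | A (z.1, z.2 + k * z.1)] = leb2 A.
Proof.
move=> mA.
have mB : measurable [set z : R * R | A (z.1, z.2 + k * z.1)].
  rewrite -[X in measurable X]setTI.
  apply: (_ : measurable_fun setT
    (fun z : R * R => (z.1, z.2 + k * z.1))) => //.
  apply: measurable_fun_pair => //.
  by apply: measurable_funD => //; apply: measurable_funM.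
split=> //; apply: eq_integral => t _ /=.
rewrite -[RHS](lebesgue_measure_translation (k * t)); last first.
  exact: measurable_xsection.
by congr lebesgue_measure; apply/seteqP; split => x /=; rewrite !xsectionE.
Qed.

(* No measurability is needed: [lebesgue_measure] is an outer measure and the
   integral of a nonnegative function is a supremum over simple functions
   below it. *)
Lemma le_leb2 A B : A `<=` B -> (leb2 A <= leb2 B)%E.
Proof.
move=> AB; rewrite /product_measure1 !ge0_integralTE//=.
apply: ereal_sup_le => _ [h hA <-]; exists h => // x.
apply: le_trans (hA x) _ => /=; apply: le_mu_ext => y.
by rewrite !xsectionE; exact: AB.
Qed.

(** In a basis [u], [v] of a symplectic plane, [omega] is [omega u v] times this form. *)
Definition det2 p q := p.1 * q.2 - p.2 * q.1.

(** For [det2 p q > 0], the open triangle with vertices [0], [p], [q], in barycentric coordinates.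
    Being open, triangles on either side of a common edge are disjoint. *)
Definition triangle p q : set (R * R) :=
  [set z | [/\ 0 < det2 p z, 0 < det2 z q & det2 p z + det2 z q < det2 p q]].

Lemma measurable_triangle p q : measurable (triangle p q).
Proof.
have m1 : measurable_fun setT (fun z : R * R => det2 p z).
  by apply: measurable_funB; apply: measurable_funM.
have m2 : measurable_fun setT (fun z : R * R => det2 z q).
  by apply: measurable_funB; apply: measurable_funM.
have m3 := measurable_funD m1 m2.
have -> : triangle p q =
    (det2 p @^-1` `]0, +oo[) `&` ((det2^~ q) @^-1` `]0, +oo[)
    `&` ((fun z => det2 p z + det2 z q) @^-1` `]-oo, det2 p q[).
  apply/seteqP; split => z /=; rewrite !in_itv/= !andbT.
    by case=> *; split.
  by move=> [[*]]; split.
apply: measurableI; first apply: measurableI.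
- by rewrite -[X in measurable X]setTI; exact: m1.
- by rewrite -[X in measurable X]setTI; exact: m2.
- by rewrite -[X in measurable X]setTI; exact: m3.
Qed.

Lemma leb2_right_triangle (d : R) : 0 < d ->
  leb2 (triangle (1, 0) (0, d)) = (d / 2)%:E.
Proof.
move=> d0; rewrite /product_measure1.
transitivity (\int[leb]_(s in `]0%R, 1%R[) (d * (1 - s))%:E)%E.
  rewrite [RHS]integral_mkcond; apply: eq_integral => s _ /=.
  have E : xsection (triangle (1, 0) (0, d)) s =
      if 0 < s < 1 then `]0, d * (1 - s)[%classic else set0.
    apply/seteqP; split => t /=; rewrite xsectionE /= /triangle /det2 /=.
      move=> -[h1 h2 h3].
      have s0 : 0 < s by rewrite -(pmulr_rgt0 _ d0); lra.
      have s1 : s < 1 by rewrite -(ltr_pM2l d0); lra.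
      by rewrite s0 s1/= in_itv/=; apply/andP; split; lra.
    case: ifPn => // /andP[s0 s1] /=; rewrite in_itv/= => /andP[t0 t1].
    have sd := mulr_gt0 s0 d0.
    by split; lra.
  rewrite E patchE mem_setE in_itv/=.
  case: ifPn => [/andP[s0 s1]|_]; last by rewrite measure0.
  rewrite lebesgue_measure_itv/= lte_fin mulr_gt0 ?subr_gt0//.
  by rewrite -EFinD subr0.
(* The interval is closed up, as the fundamental theorem of calculus is applied on [[0, 1]]. *)
rewrite -(@integral_itv_bndoo R 0 1 _ true false); last first.
  apply: measurable_funTS; apply/measurable_EFinP; apply: measurable_funM => //.
  exact: measurable_funB.
pose F := fun s : R => d * (s - s ^+ 2 / 2).
have F' (s : R) : is_derive s 1 F (d * (1 - s)).
  rewrite /F; apply: is_derive_eq.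
  by rewrite /GRing.scale /=; field.
have dF s : derivable F s 1 by case: (F' s).
have cF : continuous F.
  by move=> s; apply/differentiable_continuous/derivable1_diffP/dF.
rewrite (@continuous_FTC2 _ _ F)//.
- by rewrite -EFinD /F; congr EFin; field.
- apply: continuous_subspaceT => s; apply: cvgM; first exact: cvg_cst.
  by apply: cvgB; [exact: cvg_cst|exact: cvg_id].
- split => //.
  + by apply: cvg_at_right_filter; exact: cF.
  + by apply: cvg_at_left_filter; exact: cF.
- by move=> s _; rewrite derive1E; have [_ ->] := F' s.
Qed.

(** Shears preserve [det2], so the preimage of a triangle is again a triangle. *)
Lemma leb2_triangle_hshear (k : R) p q :
  leb2 (triangle (p.1 - k * p.2, p.2) (q.1 - k * q.2, q.2)) =
  leb2 (triangle p q).
Proof.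
rewrite -(leb2_hshear k (measurable_triangle p q)).2; congr product_measure1.
by apply/seteqP; split => z /= -[h1 h2 h3]; move: h1 h2 h3;
  rewrite /triangle/= /det2/= => h1 h2 h3; split; lra.
Qed.

Lemma leb2_triangle_vshear (k : R) p q :
  leb2 (triangle (p.1, p.2 - k * p.1) (q.1, q.2 - k * q.1)) =
  leb2 (triangle p q).
Proof.
rewrite -(leb2_vshear k (measurable_triangle p q)).2; congr product_measure1.
by apply/seteqP; split => z /= -[h1 h2 h3]; move: h1 h2 h3;
  rewrite /triangle/= /det2/= => h1 h2 h3; split; lra.
Qed.

(* At most three shears bring [p] to [(1, 0)]; a fourth one then brings [q] to
   the vertical axis. *)
Lemma leb2_triangle p q : 0 < det2 p q ->
  leb2 (triangle p q) = (det2 p q / 2)%:E.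
Proof.
have std x : 0 < det2 (1, 0) x ->
    leb2 (triangle (1, 0) x) = (det2 (1, 0) x / 2)%:E.
  case: x => x y; rewrite /det2/= => xy0.
  have [y0 e] : 0 < y /\ 1 * y - 0 * x = y by split; lra.
  rewrite -(leb2_triangle_hshear (x / y)) e -leb2_right_triangle//=.
  rewrite mulr0 subr0 (_ : x - x / y * y = 0)//.
  by rewrite divfK ?subrr// gt_eqF.
have unit x y : x.1 = 1 -> 0 < det2 x y ->
    leb2 (triangle x y) = (det2 x y / 2)%:E.
  case: x => _ b /= -> xy0.
  have e : det2 (1, 0) (y.1, y.2 - b * y.1) = det2 (1, b) y.
    by rewrite /det2/=; ring.
  rewrite -(leb2_triangle_vshear b)/= mulr1 subrr std ?e//.
have off x y : x.2 != 0 -> 0 < det2 x y ->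
    leb2 (triangle x y) = (det2 x y / 2)%:E.
  case: x => a b /= b0 xy0.
  (* This [k] makes the first coordinate [a - k * b] equal to [1]. *)
  pose k := (a - 1) / b.
  have e : det2 (a - k * b, b) (y.1 - k * y.2, y.2) = det2 (a, b) y.
    by rewrite /det2/=; ring.
  rewrite -(leb2_triangle_hshear k)/= unit ?e//= /k.
  by rewrite divfK//; ring.
case: (eqVneq p.2 0) => [p20|]; last exact: off.
case: p p20 => a b /= -> pq0.
have a0 : a != 0.
  by apply: contraTneq pq0 => ->; rewrite /det2/= !mul0r subrr ltxx.
have e : det2 (a, 0 - 1 * a) (q.1, q.2 - 1 * q.1) = det2 (a, 0) q.
  by rewrite /det2/=; ring.
(* A vertical shear moves [p] off the horizontal axis. *)
rewrite -(leb2_triangle_vshear 1)/= off ?e//=.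
by rewrite mul1r sub0r oppr_eq0.
Qed.

(* Lower area bounds witnessed by a measurable subset: they add up over disjoint
   sets without [A] being known to be measurable. *)
Definition area_ge A (r : R) :=
  exists2 B, measurable B /\ B `<=` A & (r%:E <= leb2 B)%E.

Lemma area_ge_leb2 A r : area_ge A r -> (r%:E <= leb2 A)%E.
Proof. by move=> [B [_ BA] rB]; exact: le_trans rB (le_leb2 BA). Qed.

Lemma area_ge0 A : area_ge A 0.
Proof. by exists set0; rewrite ?measure0//; split. Qed.

Lemma area_geS A B r s : A `<=` B -> s <= r -> area_ge A r -> area_ge B s.
Proof.
move=> AB sr [C [mC CA] rC]; exists C; first by split=> // z /CA/AB.
by apply: le_trans rC; rewrite lee_fin.
Qed.

Lemma area_geU A B r s : (forall z, A z -> B z -> False) ->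
  area_ge A r -> area_ge B s -> area_ge (A `|` B) (r + s).
Proof.
move=> AB0 [A' [mA A'A] rA] [B' [mB B'B] sB].
exists (A' `|` B'); first by split; [exact: measurableU|exact: setUSS].
rewrite measureU//; first by rewrite EFinD leeD.
by apply/seteqP; split => // z [/A'A Az /B'B]; exact: AB0.
Qed.

(** For [det2 p q > 0], the open sector between the rays through [p] and [q]. *)
Definition cone p q : set (R * R) := [set z | 0 < det2 p z /\ 0 < det2 z q].

Definition lin2 (s : R) p (t : R) q : R * R :=
  (s * p.1 + t * q.1, s * p.2 + t * q.2).

Definition convex2 S := forall p q s t, S p -> S q -> 0 <= s -> 0 <= t ->
  s + t = 1 -> S (lin2 s p t q).

Lemma det2_lin2l p q z s t :
  det2 (lin2 s p t q) z = s * det2 p z + t * det2 q z.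
Proof. by rewrite /det2/=; ring. Qed.

Lemma det2_lin2r p q z s t :
  det2 z (lin2 s p t q) = s * det2 z p + t * det2 z q.
Proof. by rewrite /det2/=; ring. Qed.

Lemma det2_anti p q : det2 p q = - det2 q p.
Proof. by rewrite /det2; ring. Qed.

Lemma convex2_combination3 S p q s t : convex2 S -> S 0 -> S p -> S q ->
  0 <= s -> 0 <= t -> s + t <= 1 -> S (lin2 s p t q).
Proof.
move=> cS S0 Sp Sq s0 t0 st1; set r := s + t.
have [r0|r0] := eqVneq r 0.
  have [-> ->] : s = 0 /\ t = 0 by split; rewrite /r in r0; lra.
  by rewrite /lin2 !mul0r addr0.
have r_gt0 : 0 < r by rewrite lt_neqAle eq_sym r0 addr_ge0.
have Srpq : S (lin2 (s / r) p (t / r) q).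
  by apply: cS => //; rewrite ?divr_ge0 ?(ltW r_gt0)// -mulrDl divff.
have := cS _ _ r (1 - r) Srpq S0 (ltW r_gt0); rewrite subr_ge0 subrKC.
move=> /(_ st1 erefl); congr S; rewrite /lin2/= !mulr0 !addr0.
by congr pair; field.
Qed.

Lemma triangle_sub S p q : convex2 S -> S 0 -> S p -> S q ->
  triangle p q `<=` S.
Proof.
move=> cS S0 Sp Sq z [h1 h2 h3].
have d0 : 0 < det2 p q by lra.
have -> : z = lin2 (det2 z q / det2 p q) p (det2 p z / det2 p q) q.
  case: z h1 h2 h3 => a b _ _ _; move: d0; rewrite /lin2 /det2/= => d0.
  by congr pair; field; rewrite gt_eqF.
apply: convex2_combination3 => //; try by rewrite divr_ge0// ltW.
by rewrite -mulrDl ltW// ltr_pdivrMr// mul1r addrC.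
Qed.

(** The diagonal from [0] to [u] cuts the quadrilateral [0], [p], [u], [q] into two open triangles,
    either of which may be degenerate. *)
Lemma area_ge_cone S p q u : convex2 S -> S 0 -> S p -> S q -> S u ->
  0 < det2 p q -> 0 <= det2 p u -> 0 <= det2 u q ->
  area_ge (S `&` cone p q) ((det2 p u + det2 u q) / 2).
Proof.
move=> cS S0 Sp Sq Su pq pu uq.
have tri x y : S x -> S y -> 0 <= det2 x y ->
    area_ge (S `&` cone x y) (det2 x y / 2).
  move=> Sx Sy; rewrite le_eqVlt => /predU1P[<-|xy].
    by rewrite mul0r; apply: area_geS (lexx 0) (area_ge0 set0).
  exists (triangle x y); last by rewrite leb2_triangle.
  split; first exact: measurable_triangle.
  by move=> z zT; split; [exact: triangle_sub zT|case: zT].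
have pos (x y : R) : 0 <= x -> 0 < x * y -> 0 < y.
  by rewrite le_eqVlt => /predU1P[<-|/pmulr_rgt0->//]; rewrite mul0r ltxx.
rewrite mulrDl; have := area_geU _ (tri _ _ Sp Su pu) (tri _ _ Su Sq uq).
move=> H; apply: area_geS (lexx _) (H _).
  move=> z [[Sz [h1 h2]]|[Sz [h1 h2]]]; split=> //; split=> //.
  (* A Pluecker relation: its right-hand side is positive, so a point of the sector from [p] to [u]
     also lies in the sector from [p] to [q]. *)
  - have e : det2 p u * det2 z q = det2 p z * det2 u q + det2 p q * det2 z u.
      by rewrite /det2; ring.
    apply: (pos _ _ pu); rewrite e ltr_wpDl ?mulr_gt0// mulr_ge0//; exact: ltW.
  - have e : det2 u q * det2 p z = det2 p u * det2 z q + det2 p q * det2 u z.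
      by rewrite /det2; ring.
    apply: (pos _ _ uq); rewrite e ltr_wpDl ?mulr_gt0// mulr_ge0//; exact: ltW.
by move=> z [_ [_ h1]] [_ [h2 _]]; rewrite det2_anti in h2; lra.
Qed.
End planar_area.

(** * Planar symmetric convex sets that contain their polar *)

Section polar_subset.
Variables (R : realType) (S : set (R * R)) (k : R).
Hypotheses (cptS : compact S) (cvxS : convex2 S).
Hypothesis symS : forall x, S x -> S (- x).
Hypothesis k_gt0 : 0 < k.
(** The level is [k] and not [1] because [omega] is only a multiple of [det2] in coordinates. *)
Hypothesis polarS : forall y, (forall x, S x -> det2 x y <= k) -> S y.
Implicit Types p q u v w : R * R.

Local Notation leb2 := (@lebesgue_measure R \x @lebesgue_measure R)%E.

Let S0 : S 0.
Proof. by apply: polarS => x _; rewrite /det2/= !mulr0 subrr ltW. Qed.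

Lemma continuous_det2 (T : topologicalType) (f g : T -> R * R) :
  continuous f -> continuous g -> continuous (fun x => det2 (f x) (g x)).
Proof.
move=> cf cg x.
have f1 (h : T -> R * R) : continuous h -> (h y).1 @[y --> x] --> (h x).1.
  by move=> ch; apply: continuous_comp (ch x) cvg_fst.
have f2 (h : T -> R * R) : continuous h -> (h y).2 @[y --> x] --> (h x).2.
  by move=> ch; apply: continuous_comp (ch x) cvg_snd.
by apply: cvgB; apply: cvgM; [exact: f1|exact: f2|exact: f2|exact: f1].
Qed.

Lemma det2_max v : exists2 u, S u & forall x, S x -> det2 x v <= det2 u v.
Proof.
have ne : S !=set0 by exists 0.
have [|u uS um] := @compact_EVT_max _ _ (fun x => det2 x v) S ne cptS.
  apply: continuous_subspaceT.
  apply: (continuous_det2 (f := id) (g := fun=> v)) => x.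
    exact: cvg_id.
  exact: cvg_cst.
by exists u => [|x xS]; [rewrite inE in uS|apply: um; rewrite inE].
Qed.

(** As [S] is bounded, its polar contains a small square around [0], and so does [S]. *)
Lemma det2_gt0_ex : exists p q, [/\ S p, S q, S (q - p) & 0 < det2 p q].
Proof.
have [a Sa aM] := det2_max (0, 1).
have [b Sb bM] := det2_max (1, 0).
(* [m] bounds both coordinates on [S]; the summand [1] makes it positive. *)
pose m := det2 a (0, 1) + det2 b (1, 0) + 1.
have m1 : det2 a (0, 1) >= 0.
  by have := aM 0 S0; rewrite {1}/det2/= !mul0r subrr.
have m2 : det2 b (1, 0) >= 0.
  by have := bM 0 S0; rewrite {1}/det2/= !mul0r subrr.
have m0 : 0 < m by rewrite /m; lra.
have hyp1 x : S x -> `|x.1| <= m.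
  move=> Sx; rewrite ler_norml; move: m1 m2.
  have := aM _ Sx; have := aM _ (symS Sx).
  by rewrite /m /det2/= => h1 h2 h3 h4; apply/andP; split; lra.
have hyp2 x : S x -> `|x.2| <= m.
  move=> Sx; rewrite ler_norml; move: m1 m2.
  have := bM _ Sx; have := bM _ (symS Sx).
  by rewrite /m /det2/= => h1 h2 h3 h4; apply/andP; split; lra.
pose r := k / (m + m).
have r0 : 0 < r by rewrite divr_gt0// addr_gt0.
have small w : `|w.1| <= r -> `|w.2| <= r -> S w.
  move=> w1 w2; apply: polarS => x Sx; rewrite /det2.
  apply: le_trans (ler_norm _) _; apply: le_trans (ler_normB _ _) _.
  rewrite !normrM.
  have -> : k = m * r + m * r by rewrite /r; field; rewrite gt_eqF// addr_gt0.
  by apply: lerD; apply: ler_pM => //; [exact: hyp1|exact: hyp2].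
exists (r, 0), (0, r); split.
- by apply: small; rewrite /= ?normr0 ?gtr0_norm// ltW.
- by apply: small; rewrite /= ?normr0 ?gtr0_norm// ltW.
- by apply: small; rewrite /= ?sub0r ?subr0 ?normrN ?gtr0_norm// ltW.
- by rewrite /det2/= mulr0 subr0 mulr_gt0.
Qed.

(* The hexagon with vertices [p], [q], [q - p] and their opposites is inscribed
   in [S] and has area [3 * det2 p q]. *)
Definition max_hexagon p q := [/\ S p, S q, S (q - p) &
  forall p' q', S p' -> S q' -> S (q' - p') -> det2 p' q' <= det2 p q].

(** The admissible pairs form a nonempty compact set, on which the continuous [det2] attains its
    maximum. *)
Lemma max_hexagon_ex : exists p q, max_hexagon p q /\ 0 < det2 p q.
Proof.
have [a [b [Sa Sb Sba ab]]] := det2_gt0_ex.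
pose dif (z : (R * R) * (R * R)) : R * R := z.2 - z.1.
have cdif : continuous dif.
  by move=> z; apply: cvgB; [exact: cvg_snd|exact: cvg_fst].
have clS : closed S.
  apply: compact_closed => //; exact: norm_hausdorff.
have cA : compact (S `*` S `&` dif @^-1` S).
  apply: compact_closedI; first exact: compact_setX.
  by apply: closed_comp => // z _; exact: cdif.
have ne : S `*` S `&` dif @^-1` S !=set0 by exists (a, b).
have [|z zA zm] := @compact_EVT_max _ _ (fun z => det2 z.1 z.2) _ ne cA.
  apply: continuous_subspaceT.
  apply: (continuous_det2 (f := fst) (g := snd)) => z.
    exact: cvg_fst.
  exact: cvg_snd.
have zm' p q : S p -> S q -> S (q - p) -> det2 p q <= det2 z.1 z.2.
  by move=> Sp Sq Sqp; apply: (zm (p, q)); rewrite inE.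
move: zA; rewrite inE => -[[Sz1 Sz2] Sz].
exists z.1, z.2; split; first by split.
by apply: lt_le_trans ab _; exact: zm'.
Qed.

(** Moves on by one vertex, so that what is proved for one side of the hexagon applies to all
    six. *)
Lemma max_hexagon_rot p q : max_hexagon p q -> max_hexagon q (q - p).
Proof.
move=> [Sp Sq Sqp pqM]; split=> //.
  by rewrite addrAC subrr sub0r; exact: symS.
move=> p' q' Sp' Sq' Sq'p'; apply: le_trans (pqM _ _ Sp' Sq' Sq'p') _.
by rewrite /det2/=; lra.
Qed.

(* Otherwise [q - p] is an interior point, so that moving [p] or [q] slightly
   keeps the constraints: then [det2^~ q] is at most [d = det2 p q] on [S],
   hence [(k / d) q] is in [S] by polarity, contradicting the choice of [q]. *)
Lemma max_hexagon_extremal p q l : max_hexagon p q -> 0 < det2 p q ->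
  det2 p q < k -> 1 < l -> ~ S (l * (q - p).1, l * (q - p).2).
Proof.
set d := det2 p q => -[Sp Sq _ pqM] d0 dk l1 Sl.
have l0 : 0 < l by lra.
(* Mixing [l * (q - p)] with weight [l^-1] and [(u - w) / 2] with weight [1 - l^-1] gives
   [q - p + s * (u - w)]. *)
pose s := (1 - l^-1) / 2.
have il1 : l^-1 < 1 by rewrite invf_lt1.
have il0 : 0 < l^-1 by rewrite invr_gt0.
have s0 : 0 < s by rewrite /s; lra.
have s1 : s < 1 by rewrite /s; lra.
have shift u w : S u -> S w ->
    S ((q - p).1 + s * (u.1 - w.1), (q - p).2 + s * (u.2 - w.2)).
  move=> Su Sw.
  have Suw : S (lin2 2^-1 u 2^-1 (- w)).
    by apply: cvxS => //; [exact: symS|lra].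
  have := cvxS Sl Suw (ltW il0) _ (subrKC l^-1 1); rewrite subr_ge0.
  move=> /(_ (ltW il1)); congr S; rewrite /lin2/= /s.
  by congr pair; field; rewrite gt_eqF.
have bound u : S u -> det2 u q <= d.
  move=> Su.
  have Sp' : S (lin2 (1 - s) p s u) by apply: cvxS => //; [lra|lra|lra].
  have Sqp' : S (q - lin2 (1 - s) p s u).
    have := shift p u Sp Su; congr S; rewrite /lin2/=.
    by congr pair => /=; ring.
  have := pqM _ _ Sp' Sq Sqp'; rewrite det2_lin2l -/d => h.
  rewrite -(ler_pM2l s0); lra.
have Skq : S (k / d * q.1, k / d * q.2).
  apply: polarS => x Sx.
  have -> : det2 x (k / d * q.1, k / d * q.2) = k / d * det2 x q.
    by rewrite /det2/=; ring.
  rewrite -[leRHS](divfK (lt0r_neq0 d0)) ler_pM2l ?divr_gt0//.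
  exact: bound.
have Sq' : S (lin2 (1 - s) q s (k / d * q.1, k / d * q.2)).
  by apply: cvxS => //; [lra|lra|lra].
have Sqp' : S (lin2 (1 - s) q s (k / d * q.1, k / d * q.2) - p).
  have := shift _ _ Skq Sq; congr S; rewrite /lin2/=.
  by congr pair => /=; ring.
have := pqM _ _ Sp Sq' Sqp'; rewrite det2_lin2r -/d.
have -> : det2 p (k / d * q.1, k / d * q.2) = k / d * d.
  by rewrite /d /det2/=; ring.
rewrite divfK ?gt_eqF// => h.
have : s * k <= s * d by lra.
by rewrite ler_pM2l// leNgt dk.
Qed.

(** Otherwise [det2^~ (q - p)] is bounded on [S] by some [m < k], and polarity puts
    [(k / m) (q - p)] in [S], against extremality. *)
Lemma max_hexagon_support p q : max_hexagon p q -> 0 < det2 p q ->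
  det2 p q < k -> exists2 u, S u & k <= det2 u (q - p).
Proof.
move=> pqM pq0 pqk; have [u Su uM] := det2_max (q - p).
have [ku|uk] := leP k (det2 u (q - p)); first by exists u.
(* The term [k / 2] keeps [m] positive and below [k]. *)
set m := Num.max (det2 u (q - p)) (k / 2).
have m0 : 0 < m by rewrite /m lt_max divr_gt0 ?orbT.
have mk : m < k by rewrite /m gt_max uk/=; lra.
have l1 : 1 < k / m by rewrite ltr_pdivlMr// mul1r.
case: (max_hexagon_extremal pqM pq0 pqk l1); apply: polarS => x Sx.
rewrite (_ : det2 _ _ = k / m * det2 x (q - p)); last by rewrite /det2/=; ring.
rewrite -[leRHS](divfK (lt0r_neq0 m0)) ler_pM2l ?divr_gt0//.
by rewrite /m le_max uM.
Qed.

(** If [k <= det2 p q], then [u = p] will do. Otherwise [u] is the supporting point of [q - p],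
    since [det2 u (q - p) = det2 p u + det2 u q]; extremality of [p] and [q] confines it to the
    sector. *)
Lemma max_hexagon_sector p q : max_hexagon p q -> 0 < det2 p q ->
  exists u, [/\ S u, 0 <= det2 p u, 0 <= det2 u q &
    k <= det2 p u + det2 u q].
Proof.
move=> pqM pq0; have [Sp Sq Sqp _] := pqM.
have [kpq|pqk] := leP k (det2 p q).
  have pp : det2 p p = 0 by rewrite /det2 mulrC subrr.
  by exists p; rewrite pp add0r; split => //; exact: ltW.
have rpqM := max_hexagon_rot pqM; have rrpqM := max_hexagon_rot rpqM.
have e1 : det2 q (q - p) = det2 p q by rewrite /det2/=; ring.
have e2 : det2 (q - p) (q - p - q) = det2 p q by rewrite /det2/=; ring.
have [u Su ku] := max_hexagon_support pqM pq0 pqk.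
have ku' : k <= det2 p u + det2 u q by move: ku; rewrite /det2/=; lra.
(* If [u] were outside the sector, a vertex would not be extremal on its
   ray. *)
have ray x w al be : S w -> 0 < al -> 1 + al < be ->
    u = lin2 be x (- al) w -> exists2 l, 1 < l & S (- (l * x.1, l * x.2)).
  move=> Sw al0 albe eu; have al1 : 0 < 1 + al by rewrite addr_gt0.
  exists (be / (1 + al)); first by rewrite ltr_pdivlMr// mul1r.
  apply: symS.
  have : S (lin2 (1 + al)^-1 u (al / (1 + al)) w).
    apply: cvxS => //; rewrite ?invr_ge0 ?divr_ge0 ?(ltW al1) ?(ltW al0)//.
    by rewrite -[X in X + _]mul1r -mulrDl divff// gt_eqF.
  congr S; rewrite eu /lin2/=.
  by congr pair; field; rewrite gt_eqF.
have eu : u = lin2 (det2 u q / det2 p q) p (det2 p u / det2 p q) q.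
  case: (u) => a b; move: (pq0); rewrite /lin2 /det2/= => h.
  by congr pair; field; rewrite gt_eqF.
exists u; split=> //; rewrite leNgt; apply/negP => lt0.
(* The condition [1 + al < be] amounts to [det2 p q < det2 p u + det2 u q]. The vertex contradicted
   is [- p] here and [- q] in the other case, reached by one and two rotations. *)
- have [||||l l1 Sl] := ray p q (- det2 p u / det2 p q) (det2 u q / det2 p q).
  + by [].
  + by rewrite divr_gt0// oppr_gt0.
  + by rewrite ltr_pdivlMr// mulrDl mul1r divfK ?gt_eqF//; lra.
  + by rewrite mulNr opprK.
  have := max_hexagon_extremal rpqM; rewrite e1 => /(_ _ pq0 pqk l1); apply.
  by move: Sl; congr S; congr pair; rewrite /=; ring.
- have [||||l l1 Sl] := ray q p (- det2 u q / det2 p q) (det2 p u / det2 p q).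
  + by [].
  + by rewrite divr_gt0// oppr_gt0.
  + by rewrite ltr_pdivlMr// mulrDl mul1r divfK ?gt_eqF//; lra.
  + by rewrite mulNr opprK [LHS]eu /lin2; congr pair; rewrite addrC.
  have := max_hexagon_extremal rrpqM; rewrite e2 => /(_ _ pq0 pqk l1); apply.
  by move: Sl; congr S; congr pair; rewrite /=; ring.
Qed.

Lemma area_ge_max_hexagon p q : max_hexagon p q -> 0 < det2 p q ->
  area_ge (S `&` cone p q) (k / 2).
Proof.
move=> pqM pq0; have [Sp Sq _ _] := pqM.
have [u [Su pu uq ku]] := max_hexagon_sector pqM pq0.
have := area_ge_cone cvxS S0 Sp Sq Su pq0 pu uq.
by apply: area_geS => //; rewrite ler_pM2r ?invr_gt0.
Qed.

(** Each of the six disjoint sectors of a maximal hexagon contributes [k / 2]. *)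
Lemma polar_subset_area : ((3 * k)%:E <= leb2 S)%E.
Proof.
have [p [q [M1 d1]]] := max_hexagon_ex.
have M2 := max_hexagon_rot M1; have M3 := max_hexagon_rot M2.
have M4 := max_hexagon_rot M3; have M5 := max_hexagon_rot M4.
have M6 := max_hexagon_rot M5.
have E3 : q - p - q = - p by rewrite addrAC subrr sub0r.
have E4 : - p - (q - p) = - q by rewrite opprB addrA addNr add0r.
have E5 : - q - - p = p - q by rewrite opprK addrC.
have E6 : p - q - - q = p by rewrite opprK subrK.
rewrite ?(E3, E4, E5, E6) in M2 M3 M4 M5 M6.
have A1 := area_ge_max_hexagon M1 d1.
have A2 : area_ge (S `&` cone q (q - p)) (k / 2).
  by apply: area_ge_max_hexagon => //; move: d1; rewrite /det2/=; lra.
have A3 : area_ge (S `&` cone (q - p) (- p)) (k / 2).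
  by apply: area_ge_max_hexagon => //; move: d1; rewrite /det2/=; lra.
have A4 : area_ge (S `&` cone (- p) (- q)) (k / 2).
  by apply: area_ge_max_hexagon => //; move: d1; rewrite /det2/=; lra.
have A5 : area_ge (S `&` cone (- q) (p - q)) (k / 2).
  by apply: area_ge_max_hexagon => //; move: d1; rewrite /det2/=; lra.
have A6 : area_ge (S `&` cone (p - q) p) (k / 2).
  by apply: area_ge_max_hexagon => //; move: d1; rewrite /det2/=; lra.
have A := area_geU _ A1 (area_geU _ A2 (area_geU _ A3
  (area_geU _ A4 (area_geU _ A5 A6)))).
apply: area_ge_leb2; apply: area_geS (A _ _ _ _ _).
- by move=> z; rewrite /setU/= /setI/=; tauto.
- lra.
(* Disjointness of the sectors: each one prescribes signs of two of the linear forms [det2 p z],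
   [det2 q z] and their difference, and those of distinct sectors conflict. *)
- by move=> z [_ [h1 h2]] H; move: H h1 h2 => [|[|[|[|]]]] [_ [h3 h4]];
  move: h3 h4; rewrite /det2/=; lra.
- by move=> z [_ [h1 h2]] H; move: H h1 h2 => [|[|[|]]] [_ [h3 h4]];
  move: h3 h4; rewrite /det2/=; lra.
- by move=> z [_ [h1 h2]] H; move: H h1 h2 => [|[|]] [_ [h3 h4]];
  move: h3 h4; rewrite /det2/=; lra.
- by move=> z [_ [h1 h2]] H; move: H h1 h2 => [|] [_ [h3 h4]];
  move: h3 h4; rewrite /det2/=; lra.
- by move=> z [_ [h1 h2]] H; move: H h1 h2 => [_ [h3 h4]];
  move: h3 h4; rewrite /det2/=; lra.
Qed.
End polar_subset.

(** * Symplectic planes in coordinates *)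

Lemma continuous_div_pair (R : realType) (T : topologicalType) (f g : T -> R)
    (c : R) : continuous f -> continuous g ->
  continuous (fun x => (f x / c, g x / c)).
Proof.
move=> cf cg x.
have fc : f y / c @[y --> x] --> f x / c.
  by apply: cvgM; [exact: cf|exact: cvg_cst].
have gc : g y / c @[y --> x] --> g x / c.
  by apply: cvgM; [exact: cg|exact: cvg_cst].
exact: (cvg_pair fc gc).
Qed.

Section symplectic_plane.
Variables (R : realType) (n : nat).
Implicit Types (x y z : 'rV[R]_(n + n)) (L : {vspace 'rV[R]_(n + n)}).

Lemma omega_linl x y z (a b : R) :
  omega (a *: x + b *: y) z = a * omega x z + b * omega y z.
Proof.
rewrite /omega !mulr_sumr -big_split; apply: eq_bigr => i _.
by rewrite /= !mxE; ring.
Qed.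

Lemma omega_anti x y : omega x y = - omega y x.
Proof. by rewrite omega_skew expr1 mulN1r. Qed.

Lemma omega_linr x y z (a b : R) :
  omega z (a *: x + b *: y) = a * omega z x + b * omega z y.
Proof. by rewrite omega_anti omega_linl !(omega_anti _ z); ring. Qed.

Lemma omegaxx x : omega x x = 0.
Proof. by rewrite /omega big1// => i _; rewrite mulrC subrr. Qed.

Lemma omegaNr x y : omega x (- y) = - omega x y.
Proof.
by rewrite /omega -sumrN; apply: eq_bigr => i _; rewrite !mxE; ring.
Qed.

Lemma omegaBl x y z : omega (x - y) z = omega x z - omega y z.
Proof. by rewrite -(scaleN1r y) -{1}(scale1r x) omega_linl mul1r mulN1r. Qed.

Lemma continuous_omega y : continuous (fun x => omega x y).
Proof.
have gen (T : topologicalType) (f g : 'I_n -> T -> R) (a b : 'I_n -> R) :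
    (forall i, continuous (f i)) -> (forall i, continuous (g i)) ->
    continuous (fun t => \sum_(i < n) (f i t * a i - g i t * b i)).
  move=> cf cg t; apply: cvg_big => [|i _]; first exact: add_continuous.
  by apply: cvgB; apply: cvgM; [exact: cf|exact: cvg_cst|exact: cg|
    exact: cvg_cst].
by apply: gen => i; exact: coord_continuous.
Qed.

Variable L : {vspace 'rV[R]_(n + n)}.
Hypotheses (dimL : \dim L = 2%N) (sympL : symplectic_subspace L).
Let u := (vbasis L)`_0.
Let v := (vbasis L)`_1.
Let c := omega u v.

Let uL : u \in L.
Proof. by apply: vbasis_mem; apply: mem_nth; rewrite size_tuple dimL. Qed.

Let vL : v \in L.
Proof. by apply: vbasis_mem; apply: mem_nth; rewrite size_tuple dimL. Qed.

Let span2 x : x \in L -> exists a b, x = a *: u + b *: v.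
Proof.
(* The number [m] of terms is a variable so that [\dim L = 2] can be substituted in the index
   type. *)
move=> xL; have sum2 m (f : 'I_m -> R) (w : nat -> 'rV[R]_(n + n)) : m = 2%N ->
    exists a b, \sum_(i < m) f i *: w i = a *: w 0%N + b *: w 1%N.
  by move=> m2; subst m; rewrite big_ord_recl big_ord1; do 2!eexists.
by rewrite (coord_vbasis xL); exact: (sum2 _ _ (fun i => (vbasis L)`_i)).
Qed.

(** Otherwise the first basis vector would be [omega]-orthogonal to all of [L]. *)
Lemma omega_vbasis_neq0 : omega (vbasis L)`_0 (vbasis L)`_1 != 0.
Proof.
apply/eqP => c0; have /eqP : u = 0.
  apply: sympL => // _ /span2[a [b ->]].
  by rewrite omega_linr omegaxx [omega u v]c0 !mulr0 addr0.
apply/negP; apply: (free_not0 (basis_free (vbasisP L))).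
by apply: mem_nth; rewrite size_tuple dimL.
Qed.
Let c0 : c != 0 := omega_vbasis_neq0.

Let coordE x : x \in L -> x = (omega x v / c) *: u + (omega u x / c) *: v.
Proof.
move=> /span2[a [b ->]]; rewrite omega_linl omega_linr !omegaxx -/c.
by rewrite !mulr0 addr0 add0r !mulfK.
Qed.

(** Pairing with elements of [L] does not see the component in [omega_orth L], and the pairings with
    [u] and [v] determine a vector of [L]. *)
Lemma symplectic_projE x : symplectic_proj L x =
  (omega x (vbasis L)`_1 / omega (vbasis L)`_0 (vbasis L)`_1) *: (vbasis L)`_0
  + (omega (vbasis L)`_0 x / omega (vbasis L)`_0 (vbasis L)`_1)
    *: (vbasis L)`_1.
Proof.
rewrite -/u -/v -/c.
have LL0 : (L :&: omega_orth L = 0)%VS.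
  apply/eqP; rewrite -subv0; apply/subvP => y; rewrite memv_cap.
  move=> /andP[yL /omega_orthP yL']; rewrite memv0; apply/eqP.
  apply: sympL => //; by move=> z zL; rewrite omega_anti yL' ?oppr0.
set y := _ + _.
(* The explicit candidate [y] shows that [x] lies in [L + omega_orth L], so that the two projections
   add up to [x]. *)
have yL : y \in L by rewrite memvD// memvZ.
have xyL : x - y \in omega_orth L.
  apply/omega_orthP => z /span2[a [b ->]].
  rewrite omega_anti omegaBl !omega_linr !omega_linl !omegaxx -/c.
  by rewrite (omega_anti x u) (omega_anti v u) -/c; field.
have xLL : x \in (L + omega_orth L)%VS.
  by rewrite -(subrKC y x); exact: memv_add.
have pL : symplectic_proj L x \in L by exact: memv_pi.
have e z : z \in L -> omega (symplectic_proj L x) z = omega x z.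
  move=> zL; rewrite -{2}(daddv_pi_add LL0 xLL) -/(symplectic_proj L).
  set w := daddv_pi (omega_orth L) L x.
  have /omega_orthP wL : w \in omega_orth L by exact: memv_pi.
  rewrite -(scale1r (symplectic_proj L x + w)) scalerDr omega_linl !mul1r.
  by rewrite (omega_anti w) wL// oppr0 addr0.
by rewrite (coordE pL) (omega_anti u) !e// -omega_anti.
Qed.

End symplectic_plane.

Theorem theorem6p3 (R : realType) (n : nat) (X : set 'rV[R]_(n + n)) :
  convex_body X -> centrally_symmetric X -> symplectic_polar X `<=` X ->
  (3%:E <= cyl_affine_capacity X)%E.
Proof.
move=> [cptX cvxX _] symX polarX.
apply: le_ereal_inf_tmp => _ [L [dimL sympL] <-].
rewrite /omega_area; have c0 := omega_vbasis_neq0 dimL sympL.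
have projE := symplectic_projE dimL sympL.
move: c0 projE; set u := (vbasis L)`_0; set v := (vbasis L)`_1.
set c := omega u v => c0 projE.
set S := [set ab | _].
have c_gt0 : 0 < `|c| by rewrite normr_gt0.
(* The coordinates of [symplectic_proj L x] in the basis [u], [v]. *)
pose phi x := (omega x v / c, omega u x / c).
have phi_lin x y a b : phi (a *: x + b *: y) = lin2 a (phi x) b (phi y).
  by rewrite /phi /lin2/= omega_linl omega_linr; congr pair; ring.
have phiK a b : phi (a *: u + b *: v) = (a, b).
  rewrite /phi omega_linl omega_linr !omegaxx -/c.
  by rewrite !mulr0 addr0 add0r !mulfK.
have SE : S = phi @` X.
  apply/seteqP; split => [[a b] [x Xx]|_ [x Xx <-]].
    by rewrite projE => e; exists x => //; rewrite -(phiK a b) -e phiK.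
  by exists x => //; rewrite projE.
have symX' x : X x -> X (- x) by move=> Xx; rewrite symX; exists x.
have symS x : S x -> S (- x).
  rewrite SE => -[y Xy <-]; exists (- y); first exact: symX'.
  rewrite -[- y]addr0 -(scaler0 _ 0) -scaleN1r phi_lin /lin2.
  by rewrite !mul0r !addr0 !mulN1r.
(* Level [1] for [omega] is level [1 / |c|] for [det2]; the factor [|c|] in [omega_area] cancels
   it. *)
have : ((3 * `|c|^-1)%:E <= (@lebesgue_measure R \x @lebesgue_measure R) S)%E.
  apply: polar_subset_area => //.
  - rewrite SE; apply: continuous_compact => //.
    apply: continuous_subspaceT => x.
    apply: continuous_div_pair; first exact: continuous_omega.
    rewrite (_ : omega u = fun y => omega y (- u)).
      exact: continuous_omega.
    by apply/funext => y; rewrite omegaNr omega_anti.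
  - rewrite SE => _ _ s t [x Xx <-] [y Xy <-] s0 t0 st1.
    exists (s *: x + t *: y); last by rewrite phi_lin.
    have s1 : s <= 1 by rewrite -st1 lerDl.
    have := cvxX x y (Itv01 s0 s1); rewrite !inE => /(_ Xx Xy).
    congr X; rewrite /conv/=.
    by rewrite (_ : t = 1 - s)// -st1 addrAC subrr add0r.
  - by rewrite invr_gt0.
  (* A polar point of the projection, viewed in [L], is in the polar of [X], as its pairing with [x]
     depends on [phi x] only. *)
  - move=> [a b] abP; suff XY : X (a *: u + b *: v).
      by rewrite SE; exists (a *: u + b *: v).
    apply: polarX => x Xx.
    have e : omega x (a *: u + b *: v) = c * det2 (phi x) (a, b).
      by rewrite omega_linr (omega_anti x u) /det2/=; field.
    (* The sign of [c] is unknown; symmetry of [S] bounds [det2] in absolute value. *)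
    rewrite e; apply: le_trans (ler_norm _) _.
    rewrite normrM -(ler_pM2l (x := `|c|^-1)) ?invr_gt0// mulKf ?gt_eqF// mulr1.
    have Sx : S (phi x) by rewrite SE; exists x.
    rewrite ler_norml lerNl abP// andbT.
    have := abP _ (symS _ Sx); congr (_ <= _).
    by rewrite /det2/=; ring.
rewrite -(@lee_pmul2l _ `|c|%:E)// ?lte_fin//.
by rewrite -EFinM mulrCA mulfV ?gt_eqF// mulr1.
Qed.
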